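(* Let $X$ be a chainable continuum and let $x\in X$. Then (1) $x$ is an endpoint of $X$ if and only if there exists an ultrafilter order $\leq_{\mathcal{U}}^{\mathcal{D}}$ on $X$ such that $x$ is minimal or maximal with respect to $\leq_{\mathcal{U}}^{\mathcal{D}}$; (2) if $x$ is an absolute endpoint of $X$, then for every ultrafilter order $\leq_{\mathcal{U}}^{\mathcal{D}}$ on $X$ the point $x$ is minimal or maximal with respect to $\leq_{\mathcal{U}}^{\mathcal{D}}$.
   Context: A continuum is a compact connected metrizable space; fix a metric generating its topology. A chain in $X$ is a finite sequence of open sets $d_1,\dots,d_k$ (its links) with $d_i\cap d_j\neq\varnothing\iff|i-j|\le 1$; its mesh is the maximum of the diameters of its links, and an $\varepsilon$-chain is a chain of mesh less than $\varepsilon$. $X$ is chainable if for every $\varepsilon>0$ it is covered by an $\varepsilon$-chain. $\mathbb{N}=\{1,2,3,\dots\}$. Let $\mathcal{D}=\{D_n\}_{n\in\mathbb{N}}$ be a sequence of chains $D_n=\{d_{1,n},\dots,d_{k_n,n}\}$, each covering $X$, with $\mathrm{mesh}(D_n)\to 0$, and let $\mathcal{U}$ be a non-principal ultrafilter on $\mathbb{N}$. Write $x\leq_{D_n}y$ iff there exist $i\le j\le k_n$ with $x\in d_{i,n}$ and $y\in d_{j,n}$, and $x\leq_{\mathcal{U}}^{\mathcal{D}}y$ iff $\{n\in\mathbb{N}: x\leq_{D_n}y\}\in\mathcal{U}$. This is a linear order on $X$. An ultrafilter order on $X$ is any order of the form $\leq_{\mathcal{U}}^{\mathcal{D}}$ for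 some such $\mathcal{D}$ and $\mathcal{U}$. A point $x\in X$ is an endpoint of $X$ if for every $\varepsilon>0$ there is an $\varepsilon$-chain covering $X$ such that only the first link of the chain contains $x$. A point $x\in X$ is an absolute endpoint of $X$ if for every $\varepsilon>0$ there is $\delta>0$ such that whenever $\{d_1,\dots,d_n\}$ is a $\delta$-chain covering $X$ and $x\in d_k$, then $\bigcup_{j=1}^kd_j\subseteq B(x,\varepsilon)$ or $\bigcup_{j=k}^nd_j\subseteq B(x,\varepsilon)$, where $B(x,\varepsilon)$ is the open ball of radius $\varepsilon$ around $x$. *)

(* Defs.v *)
From HB Require Import structures.
From mathcomp Require Import all_boot all_order all_algebra.
From mathcomp Require Import all_classical all_reals all_analysis.

Set Implicit Arguments.
Unset Strict Implicit.
Unset Printing Implicit Defensive.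

Import Order.TTheory GRing.Theory Num.Theory.

Local Open Scope classical_set_scope.
Local Open Scope ring_scope.

(* Nonemptiness is not required here: a point of [X] is always at hand. *)
Definition continuum (R : realType) (X : metricType R) : Prop :=
  compact [set: X] /\ connected [set: X].

(* A finite sequence of subsets; links are indexed from 0. *)
Definition link (T : Type) (d : seq (set T)) (i : nat) : set T := nth set0 d i.

Definition is_chain (T : topologicalType) (d : seq (set T)) : Prop :=
  (forall i : 'I_(size d), open (link d i)) /\
  (forall i j : 'I_(size d),
     link d i `&` link d j !=set0 <-> (`|(i : nat)%:Z - (j : nat)%:Z| <= 1)).

Definition covers (T : Type) (d : seq (set T)) : Prop :=
  \bigcup_(i : 'I_(size d)) link d i = [set: T].

(* Extended-real valued, so that an unbounded set has diameter +oo; the empty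
   set has diameter -oo, but the links of a chain are nonempty. *)
Definition diam (R : realType) (X : metricType R) (A : set X) : \bar R :=
  ereal_sup [set (mdist p.1 p.2)%:E | p in A `*` A].

(* Nonempty sets have nonnegative diameter, so starting the maximum at 0 does
   not change its value on a nonempty chain. *)
Definition mesh (R : realType) (X : metricType R) (d : seq (set X)) : \bar R :=
  \big[maxe/0%E]_(A <- d) diam A.

Definition eps_chain (R : realType) (X : metricType R) (e : R)
    (d : seq (set X)) : Prop :=
  is_chain d /\ (mesh d < e%:E)%E.

Definition chainable (R : realType) (X : metricType R) : Prop :=
  forall e : R, 0 < e -> exists d : seq (set X), eps_chain e d /\ covers d.

Definition chain_le (T : Type) (d : seq (set T)) (x y : T) : Prop :=
  exists i j : 'I_(size d), [/\ (i <= j)%N, link d i x & link d j y].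

Definition ultra_le (T : Type) (D : nat -> seq (set T)) (U : set_system nat)
    (x y : T) : Prop :=
  U [set n | chain_le (D n) x y].

Definition vanishing_chain_covers (R : realType) (X : metricType R)
    (D : nat -> seq (set X)) : Prop :=
  (forall n, is_chain (D n) /\ covers (D n)) /\
  mesh (D n) @[n --> \oo] --> 0%E.

Definition nonprincipal (T : Type) (U : set_system T) : Prop :=
  forall t : T, U <> principal_filter t.

Definition ultrafilter_order (R : realType) (X : metricType R)
    (r : X -> X -> Prop) : Prop :=
  exists (D : nat -> seq (set X)) (U : set_system nat),
    [/\ vanishing_chain_covers D, UltraFilter U, nonprincipal U
      & r = ultra_le D U].

Definition minimal (T : Type) (r : T -> T -> Prop) (x : T) : Prop :=
  forall y, r y x -> y = x.

Definition maximal (T : Type) (r : T -> T -> Prop) (x : T) : Prop :=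
  forall y, r x y -> y = x.

Definition endpoint (R : realType) (X : metricType R) (x : X) : Prop :=
  forall e : R, 0 < e -> exists d : seq (set X),
    [/\ eps_chain e d, covers d
      & forall i : 'I_(size d), link d i x <-> i = 0%N :> nat].

Definition absolute_endpoint (R : realType) (X : metricType R) (x : X) : Prop :=
  forall e : R, 0 < e -> exists2 delta : R, 0 < delta &
    forall d : seq (set X), eps_chain delta d -> covers d ->
    forall k : 'I_(size d), link d k x ->
      \bigcup_(j in [set j : 'I_(size d) | (j <= k)%N]) link d j `<=` ball x e
      \/
      \bigcup_(j in [set j : 'I_(size d) | (k <= j)%N]) link d j `<=` ball x e.

(* Main.v *)
Require Import Defs.
From mathcomp Require Import all_boot all_order all_algebra.
From mathcomp Require Import all_classical all_reals all_analysis.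
From mathcomp Require Import zify lra.

(** Absolute endpoints are extremal because a fine enough chain has all its
    links on one side of [x] close to [x], so that no point stays below [x] and
    another one above [x] for infinitely many chains.  A sequence of chains
    witnessing that [x] is an endpoint makes [x] minimal for every ultrafilter.
    The remaining implication, that a minimal or maximal [x] is an endpoint,
    is the substance of the file.

    If [A] and [B] are closed connected sets containing [x] and [a], [b] are
    points of [A] outside [B] and of [B] outside [A], then every fine chain
    puts [x] between [a] and [b]: otherwise one of the sets, being connected,
    would run through a link around the point it misses.  Hence [x] is neither
    minimal nor maximal.  So, when [x] is extremal, the subcontinua containing
    [x] are totally ordered by inclusion ([extremal_comparable]), and it
    remains to build, from this, fine chains starting at [x].

    A fine chain covering [X] is read as a walk: a continuous function [u],
    vanishing at [x] and almost injective ([chain_coordinate]), is sampled along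
    the links, [x] being met at some intermediate time [k].  The chain is to be
    folded at time [k], so that links before [k] are merged with links after
    [k] where [u] takes almost the same value.  After rounding [u] to integers
    this becomes a statement on integer walks ([fold_walk]): the part of the
    walk going left from [k] and the part going right can be folded together
    if they discover new values in the same order, that is, it never happens
    that the left part reaches [v] before [w] and the right part reaches [w]
    before [v], where [v] and [w] lie on either side of the value at [k].

    If such a crossing happened along the ultrafilter for fixed [v] and [w],
    the ultralimits of the left and of the right parts would be two continua
    containing [x], one reaching [v] within [u <= w] and the other reaching [w]
    within [v <= u].  Total ordering of the continua does not exclude this for
    every pair, as both may have exactly [v] and [w] as extreme values of [u].
    It does show that two such pairs are never strictly increasing in both
    coordinates ([crossing_antitone]), so that they form a thin set, and the
    rounding thresholds can be shifted off it ([generic_shifts]).  With such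
    thresholds the sampled walks are foldable for almost all chains, and the
    folded chain has [x] in its first link only
    ([folded_chain_endpoint]). *)

Set Implicit Arguments.
Unset Strict Implicit.
Unset Printing Implicit Defensive.

Import Order.TTheory GRing.Theory Num.Theory.
Import numFieldNormedType.Exports.

Local Open Scope classical_set_scope.
Local Open Scope ring_scope.

(** * Folding integer walks *)

Definition steps1 (M : nat) (f : nat -> int) : Prop :=
  forall t, (t < M)%N -> `|f t.+1 - f t| <= 1.

(** The half walks leaving [k] to the left and to the right never meet two values
    in opposite orders; the mirror images of the excluded pairs are excluded by
    the same condition on the opposite walk. *)
Definition noncrossing (k M : nat) (f : nat -> int) : Prop :=
  forall i j, (i <= k <= j)%N -> (j <= M)%N ->
    (forall t, (i <= t <= k)%N -> f t < f j) ->
    (forall t, (k <= t <= j)%N -> f i < f t) -> False.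

Lemma last_failure_before (p : pred nat) (i k : nat) : (i <= k)%N -> p k ->
  exists2 i', (i <= i' <= k)%N &
    (forall t, (i' <= t <= k)%N -> p t) /\ ((i < i')%N -> ~~ p i'.-1).
Proof.
elim: k => [|k IHk] ik pk.
  by exists 0%N; [lia | split=> [t tk|]; [have -> : t = 0%N by lia | lia]].
have single : forall t, (k.+1 <= t <= k.+1)%N -> p t.
  by move=> t tk; have -> : t = k.+1 by lia.
case: (eqVneq i k.+1) => [->|nik]; first by exists k.+1; [lia | split=> //; lia].
case: (boolP (p k)) => [pk'|npk]; last by exists k.+1; [lia | split].
have [|i' i'k [pi' fi']] := IHk _ pk'; first by lia.
exists i'; [lia | split=> // t tk].
by case: (eqVneq t k.+1) => [->//|ntk]; apply: pi'; lia.
Qed.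

Lemma first_failure_after (p : pred nat) (k j : nat) : (k <= j)%N -> p k ->
  exists2 j', (k <= j' <= j)%N &
    (forall t, (k <= t <= j')%N -> p t) /\ ((j' < j)%N -> ~~ p j'.+1).
Proof.
elim: j => [|j IHj] kj pk.
  by exists 0%N; [lia | split=> [t tk|]; [have -> : t = k by lia | lia]].
case: (eqVneq k j.+1) => [kj1|nkj].
  exists k; first by lia.
  by split=> [t tk|]; [have -> : t = k by lia | lia].
have [|j' j'k [pj' fj']] := IHj _ pk; first by lia.
case: (boolP ((j' == j) && p j.+1)) => [/andP[/eqP j'j pj]|].
  exists j.+1; [lia | split=> [t tk|]; last by lia].
  by case: (eqVneq t j.+1) => [->//|ntk]; apply: pj'; lia.
rewrite negb_and => h; exists j'; first by lia.
split=> // j'j; case: (eqVneq j' j) h => [->//|njj _]; apply: fj'; lia.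
Qed.

Lemma max_on_segment (f : nat -> int) (i j : nat) : (i <= j)%N ->
  exists2 m, (i <= m <= j)%N & forall t, (i <= t <= j)%N -> f t <= f m.
Proof.
elim: j => [|j IHj] ij.
  by exists 0%N; [lia | move=> t ti; have -> : t = 0%N by lia].
case: (eqVneq i j.+1) => [->|nij].
  by exists j.+1; [lia | move=> t ti; have -> : t = j.+1 by lia].
have [|m mij fm] := IHj; first by lia.
case: (lerP (f j.+1) (f m)) => fj.
  exists m; first by lia.
  by move=> t ti; case: (eqVneq t j.+1) => [->//|ntj]; apply: fm; lia.
exists j.+1; first by lia.
move=> t ti; case: (eqVneq t j.+1) => [->//|ntj].
by apply/ltW/le_lt_trans/fj; apply: fm; lia.
Qed.

(** The next three lemmas isolate the arithmetic of the last, monotone, run of a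
   folded walk, along which the position is a constant plus the depth below the
   maximal value [b]. *)
Lemma depth_step (b x y : int) (c : nat) : x <= b -> y <= b -> `|y - x| <= 1 ->
  (c + absz (b - y)%R <= (c + absz (b - x)%R).+1)%N /\
  (c + absz (b - x)%R <= (c + absz (b - y)%R).+1)%N.
Proof. by lia. Qed.

Lemma depth_inj (b x y : int) (c : nat) : x <= b -> y <= b ->
  (c + absz (b - x)%R = c + absz (b - y)%R)%N -> x = y.
Proof. by lia. Qed.

Lemma depth_max (a b x : int) (c : nat) : a < x -> x <= b ->
  (c + absz (b - x)%R <= c + absz (b - (a + 1))%R)%N.
Proof. by lia. Qed.

(** The segment [i, j] around [k] is a component of the set of times where
    [f > a].  Its folding [P] is built from the inside: with [f m] the maximum on
    the segment, the component [i', j'] of [f < f m] around [k] is folded by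
    induction, for the opposite walk, and the rest of the segment is laid on one
    further run that descends from [f m] to [a + 1].  This is continuous because
    the inner component can only be left at its last position, [p0].  A half walk
    leaving the outer segment through [a] has already seen [f m], since otherwise
    it would cross the half walk that has; hence both exits of the outer segment
    again lie at the last position, which keeps the induction going. *)
Lemma fold_segment (n : nat) : forall (f : nat -> int) (k M i j : nat) (a : int),
  (j - i < n)%N -> (i <= k <= j)%N -> (j <= M)%N -> steps1 M f ->
  noncrossing k M f -> noncrossing k M (fun t => - f t) ->
  (forall t, (i <= t <= j)%N -> a < f t) ->
  ((0 < i)%N -> f i.-1 = a) -> ((j < M)%N -> f j.+1 = a) ->
  exists (P : nat -> nat) (p0 : nat),
    [/\ P k = 0%N,
        forall t, (i <= t < j)%N -> (P t.+1 <= (P t).+1)%N /\ (P t <= (P t.+1).+1)%N,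
        forall s t, (i <= s <= j)%N -> (i <= t <= j)%N -> P s = P t -> f s = f t,
        forall t, (i <= t <= j)%N -> (P t <= p0)%N
      & ((0 < i)%N -> P i = p0) /\ ((j < M)%N -> P j = p0)].
Proof.
elim: n => [//|n IHn] f k M i j a jin kij jM f1 nc ncN fa fia fja.
have [|m mij fm] := @max_on_segment f i j; first by lia.
have seg t : (i <= t < j)%N -> [/\ (i <= t <= j)%N, (i <= t.+1 <= j)%N & (t < M)%N].
  by clear - jM => tij; split; lia.
have fi : (0 < i)%N -> f i = a + 1.
  move=> i0; have := fa i; have := f1 i.-1; rewrite prednK // fia //; lia.
have fj : (j < M)%N -> f j = a + 1.
  move=> jM'; have := fa j; have := f1 j; rewrite fja //; lia.
case: (eqVneq (f k) (f m)) => [fkm|fkm].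
  exists (fun t => absz (f m - f t)%R), (absz (f m - (a + 1))%R); split.
  - by rewrite fkm subrr.
  - move=> t /seg[t1 t2 t3].
    by apply: (@depth_step _ _ _ 0); [exact: fm | exact: fm | exact: f1].
  - by move=> s t sij tij; apply: (@depth_inj (f m) _ _ 0); exact: fm.
  - by move=> t tij; apply: (@depth_max _ _ _ 0); [exact: fa | exact: fm].
  - by split=> [/fi ->|/fj ->].
have fkm' : f k < f m by have := fm k kij; lia.
have [|i' i'k [fi' ei']] := @last_failure_before (fun t => f t < f m) i k _ fkm'.
  by lia.
have [|j' j'k [fj' ej']] := @first_failure_after (fun t => f t < f m) k j _ fkm'.
  by lia.
have fk := fa k kij.
(* The left half, if it leaves the segment, has met the maximum before. *)
have ii' : (0 < i)%N -> (i < i')%N.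
  move=> i0; rewrite ltnNge; apply/negP => i'i.
  have mk : (k < m)%N.
    rewrite ltnNge; apply/negP => mk; have := fi' m; rewrite ltxx; lia.
  apply: (nc i.-1 m); try lia.
  - move=> t tk; case: (eqVneq t i.-1) => [->|nti]; first by rewrite fia //; lia.
    by apply: fi'; lia.
  - by move=> t tk; rewrite fia //; apply: fa; lia.
have jj' : (j < M)%N -> (j' < j)%N.
  move=> jM'; rewrite ltnNge; apply/negP => j'j.
  have mk : (m < k)%N.
    rewrite ltnNge; apply/negP => mk; have := fj' m; rewrite ltxx; lia.
  apply: (ncN m j.+1); try lia.
  - by move=> t tk; rewrite fja // ltrN2; apply: fa; lia.
  - move=> t tk; rewrite ltrN2; case: (eqVneq t j.+1) => [->|ntj].
      by rewrite fja //; lia.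
    by apply: fj'; lia.
have fi'm : (i < i')%N -> f i'.-1 = f m.
  by move=> ii; have := ei' ii; have := fm i'.-1; lia.
have fj'm : (j' < j)%N -> f j'.+1 = f m.
  by move=> jj; have := ej' jj; have := fm j'.+1; lia.
have mN : ~~ (i' <= m <= j')%N.
  apply/negP => mij'; have := fi' m; have := fj' m; rewrite ltxx.
  by case: (leqP m k) => mk; lia.
have [] := IHn (fun t => - f t) k M i' j' (- f m).
- by lia.
- by lia.
- by lia.
- by move=> t tM; have := f1 t tM; lia.
- exact: ncN.
- move=> i1 j1 h1 h2 h3 h4.
  by apply: (nc i1 j1) => // t ht; [have := h3 t ht | have := h4 t ht]; lia.
- move=> t tij; rewrite ltrN2; case: (leqP t k) => tk; [apply: fi'|apply: fj']; lia.
- by move=> i0; rewrite fi'm //; case: (posnP i) => [->//|]; apply: ii'.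
- by move=> jM'; rewrite fj'm //; case: (ltnP j M) => [/jj'//|]; lia.
move=> P [p0 [Pk P1 Pf Pp0 [Pi Pj]]].
pose Q t := if (i' <= t <= j')%N then P t else (p0.+1 + absz (f m - f t)%R)%N.
exists Q, (p0.+1 + absz (f m - (a + 1))%R)%N; rewrite /Q; split.
- by rewrite ifT //; lia.
- move=> t tij; have [t1 t2 t3] := seg t tij.
  case: ifPn => Ht1; case: ifPn => Ht.
  + by apply: P1; lia.
  + have ti' : t = i'.-1 by clear - tij Ht1 Ht; lia.
    have i'0 : (0 < i')%N by clear - Ht1 Ht; lia.
    have ii : (i < i')%N by clear - tij Ht1 Ht; lia.
    by rewrite ti' prednK // fi'm // Pi // subrr addn0; clear; lia.
  + have tj' : t = j' by clear - tij Ht1 Ht; lia.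
    have jj : (j' < j)%N by clear - tij Ht1 Ht; lia.
    by rewrite tj' fj'm // Pj ?(leq_trans jj) // subrr addn0; clear; lia.
  + by apply: depth_step; [exact: fm | exact: fm | exact: f1].
- move=> s t sij tij; case: ifPn => Hs; case: ifPn => Ht.
  + by move=> PP; apply: oppr_inj; apply: Pf.
  + move: (Pp0 s Hs) => + PP; rewrite PP addSn => /(leq_ltn_trans (leq_addr _ _)).
    by rewrite ltnn.
  + move: (Pp0 t Ht) => + PP; rewrite -PP addSn => /(leq_ltn_trans (leq_addr _ _)).
    by rewrite ltnn.
  + by apply: depth_inj; exact: fm.
- move=> t tij; case: ifPn => Ht; last by apply: depth_max; [exact: fa | exact: fm].
  by apply: (leq_trans (Pp0 t Ht)); rewrite addSn ltnW // ltnS leq_addr.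
- split=> [i0|jM'].
  + by rewrite ifF ?fi //; have := ii' i0; lia.
  + by rewrite ifF ?fj //; have := jj' jM'; lia.
Qed.

(** [P] folds the walk at time [k]: it is again a walk, it starts at time [k],
    and [f] is a function of it. *)
Lemma fold_walk (f : nat -> int) (k M : nat) : (k <= M)%N -> steps1 M f ->
  noncrossing k M f -> noncrossing k M (fun t => - f t) ->
  exists P : nat -> nat,
    [/\ P k = 0%N,
        forall t, (t < M)%N -> (P t.+1 <= (P t).+1)%N /\ (P t <= (P t.+1).+1)%N
      & forall s t, (s <= M)%N -> (t <= M)%N -> P s = P t -> f s = f t].
Proof.
move=> kM f1 nc ncN.
have [//|m _ fm] := @max_on_segment (fun t => - f t) 0 M.
have fa t : (0 <= t <= M)%N -> f m - 1 < f t by move=> tM; have := fm t tM; lia.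
have kM' : (0 <= k <= M)%N by [].
have lM : (M - 0 < M.+1)%N by rewrite subn0.
have h0 : (0 < 0)%N -> f 0.-1 = f m - 1 by [].
have hM : (M < M)%N -> f M.+1 = f m - 1 by rewrite ltnn.
have [P [p0 [Pk P1 Pf _ _]]] := fold_segment lM kM' (leqnn M) f1 nc ncN fa h0 hM.
by exists P; split.
Qed.

(** * Grids avoiding an antitone relation *)

(** The unit interval has positive measure. *)
Lemma countable_avoid (R : realType) (S : set R) : countable S ->
  exists2 a : R, 0 < a < 1 & ~ S a.
Proof.
move=> cS; apply: contrapT => noa.
have sub : `]0, 1[%classic `<=` S.
  move=> a /=; rewrite in_itv /= => a01.
  by apply: contrapT => nSa; apply: noa; exists a.
have cI : countable `]0, (1 : R)[%classic.
  exact: sub_countable (subset_card_le sub) cS.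
have := countable_lebesgue_measure0 cI.
rewrite lebesgue_measure_itv /= lte_fin ltr01 => /eqP.
by rewrite -EFinB subr0 eqe oner_eq0.
Qed.

(** An antitone relation is a monotone curve: the vertical gaps over distinct
    abscissae are disjoint intervals, so only countably many are nonempty. *)
Lemma countable_plateaus (R : realType) (Q : R -> R -> Prop) :
  (forall v w v' w', Q v w -> Q v' w' -> v < v' -> w < w' -> False) ->
  countable [set v | exists w1 w2, [/\ w1 < w2, Q v w1 & Q v w2]].
Proof.
move=> antiQ; set S := (X in countable X).
have [w hw] : {w : R -> R * R & forall v, (w v).1 < (w v).2 /\
    (S v -> Q v (w v).1 /\ Q v (w v).2)}.
  apply: (@choice _ _ (fun v p => p.1 < p.2 /\ (S v -> Q v p.1 /\ Q v p.2))) => v.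
  have [[w1 [w2 [w12 Q1 Q2]]]|nS] := pselect (S v); first by exists (w1, w2).
  by exists (0, 1); rewrite /= ltr01.
apply: (@separated_open_countable _ _ (fun v => `](w v).1, (w v).2[%classic)).
- by move=> v; exact: interval_open.
- move=> v; have [w12 _] := hw v; exists (((w v).1 + (w v).2) / 2).
  by rewrite /= in_itv /= !midf_lt.
- have disj : forall v v', S v -> S v' -> v < v' ->
      `](w v).1, (w v).2[ `&` `](w v').1, (w v').2[ !=set0 -> False.
    move=> v v' Sv Sv' vv' [t [/=]]; rewrite !in_itv /=.
    move=> /andP[t1 _] /andP[_ t2'].
    have [_ /(_ Sv)[Q1 _]] := hw v; have [_ /(_ Sv')[_ Q2']] := hw v'.
    exact: antiQ Q1 Q2' vv' (lt_trans t1 t2').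
  move=> v v' Sv Sv' ne; case: (ltgtP v v') => // vv'; exfalso.
    exact: disj vv' ne.
  by apply: disj vv' _ => //; rewrite setIC.
Qed.

(** First [a] is chosen off the countably many abscissae carrying several points
    of the curve, and then [b] off the countably many ordinates that remain over
    the abscissae [- (a + i)]. *)
Lemma generic_shifts (R : realType) (Q : R -> R -> Prop) :
  (forall v w v' w', Q v w -> Q v' w' -> v < v' -> w < w' -> False) ->
  exists a b : R, [/\ 0 < a < 1, 0 < b < 1 &
    forall i j : nat, ~ Q (- (a + i%:R)) (b + j%:R)].
Proof.
move=> antiQ; have := countable_plateaus antiQ; set S := (X in countable X) => cS.
have [a a01 Sa] : exists2 a : R, 0 < a < 1 &
    ~ (\bigcup_(i : nat) ((fun v => - v - i%:R) @` S)) a.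
  apply: countable_avoid; apply: bigcup_countable => // i _.
  exact: sub_countable (card_image_le _ _) cS.
have [b b01 Qb] : exists2 b : R, 0 < b < 1 &
    ~ (\bigcup_(i : nat) \bigcup_(j : nat)
        [set b | Q (- (a + i%:R)) (b + j%:R)]) b.
  apply: countable_avoid; apply: bigcup_countable => // i _.
  apply: bigcup_countable => // j _; set T := (X in countable X).
  have [->|/set0P[b0 Tb0]] := eqVneq T set0; first exact: countable0.
  apply: (@sub_countable _ _ _ [set b0]) (countable1 b0).
  apply: subset_card_le => b1 Tb1 /=; apply: contrapT => b10; apply: Sa.
  exists i => //; exists (- (a + i%:R)); last by lra.
  have [b01|b01|//] := ltgtP b1 b0.
    by exists (b1 + j%:R), (b0 + j%:R); rewrite ltrD2r.
  by exists (b0 + j%:R), (b1 + j%:R); rewrite ltrD2r.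
exists a, b; split=> // i j Qij; apply: Qb.
by exists i => //; exists j.
Qed.

(** * Ultralimits of walks *)

Lemma nonprincipal_cofinite (U : set_system nat) (N : nat) :
  UltraFilter U -> nonprincipal U -> U [set n | (N <= n)%N].
Proof.
move=> UU npU; elim: N => [|N IHN]; first by apply: filterS filterT => n.
have [UN|UN] := in_ultra_setVsetC [set N] UU.
  exfalso; apply: (npU N); apply/esym/(@max_filter _ _ UU).
    exact: principal_filter_proper.
  move=> A UA; apply/principal_filterP.
  by have [n [An <-]] := filter_ex (filterI UA UN).
apply: filterS2 IHN UN => n /= Nn nN.
by rewrite ltn_neqAle Nn andbT; apply/eqP => nN'; exact: nN.
Qed.

Lemma nonprincipal_eventually (U : set_system nat) (P : set nat) :
  UltraFilter U -> nonprincipal U -> (\forall n \near \oo, P n) -> U P.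
Proof.
by move=> UU npU [N _ NP]; apply: filterS (nonprincipal_cofinite N UU npU).
Qed.

Lemma ultra_cvg_compact (T : Type) (X : topologicalType) (U : set_system T)
    (p : T -> X) :
  UltraFilter U -> compact [set: X] -> exists l : X, p @ U --> l.
Proof.
move=> UU cX; have [|l [_ pl]] := cX (p @ U) _; first exact: filterT.
exists l => V Vl; have [//|nV] := in_ultra_setVsetC (p @^-1` V) UU.
by have [z [nVz Vz]] := pl (~` V) V nV Vl.
Qed.

Definition ultralimit (T : Type) (X : topologicalType) (U : set_system T)
    (A : T -> set X) : set X :=
  [set a | forall V, nbhs a V -> U [set n | A n `&` V !=set0]].

Section ultralimit.
Variables (T : Type) (X : topologicalType) (U : set_system T).
Hypothesis UU : UltraFilter U.
Implicit Types (A : T -> set X).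

Lemma ultralimit_closed A : closed (ultralimit U A).
Proof.
move=> a ca V /nbhs_interior aV; have [b [Lb Vb]] := ca _ aV.
apply: filterS (Lb _ Vb) => n [c [Ac Vc]].
by exists c; split=> //; exact: interior_subset.
Qed.

Lemma ultralimit_mem A (p : T -> X) (l : X) :
  U [set n | A n (p n)] -> p @ U --> l -> ultralimit U A l.
Proof.
move=> Ap pl V lV; have pV : U (p @^-1` V) := pl V lV.
by apply: filterS2 Ap pV => n Apn Vpn; exists (p n).
Qed.

Lemma ultralimit_sub A K :
  closed K -> U [set n | A n `<=` K] -> ultralimit U A `<=` K.
Proof.
move=> cK AK a La; apply: cK => V aV.
have [n [[c [Ac Vc]] AKn]] := filter_ex (filterI (La V aV) AK).
by exists c; split=> //; exact: AKn.
Qed.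

End ultralimit.

(** A walk with steps shorter than [c2 - c1] cannot jump over [c1, c2]. *)
Lemma walk_ivt (R : realType) (h : nat -> R) (s t a b : nat) (c1 c2 : R) :
  (s <= a <= t)%N -> (s <= b <= t)%N -> h a < c1 -> c2 < h b -> c1 < c2 ->
  (forall j, (s <= j < t)%N -> `|h j.+1 - h j| < c2 - c1) ->
  exists2 j, (s <= j <= t)%N & c1 <= h j <= c2.
Proof.
move=> sat sbt ha hb c12 h1; have [ab|ba] := leqP a b.
  have [j ajb [hj ej]] := @first_failure_after (fun j => h j < c1) a b ab ha.
  have jb : (j < b)%N.
    rewrite ltn_neqAle; case/andP: (ajb) => aj ->; rewrite andbT.
    apply/eqP => jb; have := hj j; rewrite aj leqnn jb => /(_ isT); lra.
  exists j.+1; first by lia.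
  have := ej jb; rewrite -leNgt => -> /=.
  have /h1 : (s <= j < t)%N by lia.
  have := hj j; rewrite leqnn andbT; case/andP: ajb => -> _ /(_ isT).
  rewrite ltr_norml; lra.
have [j ajb [hj ej]] := @last_failure_before (fun j => h j < c1) b a (ltnW ba) ha.
have bj : (b < j)%N.
  rewrite ltn_neqAle; case/andP: (ajb) => -> ja; rewrite andbT.
  apply/eqP => jb; have := hj j; rewrite ja leqnn -jb => /(_ isT); lra.
exists j.-1; first by lia.
have := ej bj; rewrite -leNgt => -> /=.
have /h1 : (s <= j.-1 < t)%N by lia.
rewrite prednK; last by lia.
have := hj j; rewrite leqnn; case/andP: ajb => _ -> /(_ isT).
rewrite ltr_norml; lra.
Qed.

(** Heine-Cantor, read off the formulation of compactness by near coverings. *)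
Lemma compact_uniform (R : realType) (X : metricType R) (g : X -> R) (e : R) :
  compact [set: X] -> continuous g -> 0 < e ->
  exists2 d, 0 < d & forall p q, mdist p q < d -> `|g p - g q| < e.
Proof.
move=> /compact_near_coveringP cX cg e0.
have e20 : 0 < e / 2 by rewrite divr_gt0.
have := cX R (0^'+) (fun d x => forall q, mdist x q < d -> `|g x - g q| < e) _.
case=> [x _|d /= d0 /(_ (d / 2))].
  have /(cvgrPdist_lt _ _).1/(_ _ e20) := cg x.
  rewrite -nbhs_ballE => -[r /= r0 rg].
  exists (ball x (r / 2), [set d | d < r / 2]) => /=.
    split; first by apply: nbhsx_ballx; rewrite divr_gt0.
    by apply: nbhs_right_lt; rewrite divr_gt0.
  move=> [y d] /= [xy dr] q yq.
  have gy : `|g x - g y| < e / 2.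
    by apply: rg; apply: le_ball xy; rewrite ler_pdivrMr //; lra.
  have gq : `|g x - g q| < e / 2.
    apply: rg; rewrite [r]splitr; apply: ball_triangle xy _.
    by rewrite ballEmdist /=; exact: lt_trans dr.
  by rewrite (splitr e) (le_lt_trans (ler_distD (g x) _ _)) // ltrD // distrC.
rewrite /ball_ /= sub0r normrN gtr0_norm ?divr_gt0 //.
rewrite ltr_pdivrMr // ltr_pMr // ltr1n => /(_ isT isT) h.
exists (d / 2); first by rewrite divr_gt0.
by move=> p q pq; apply: h.
Qed.

Definition walk_trace (X : Type) (y : nat -> X) (s t : nat) : set X :=
  [set y j | j in [set j | (s <= j <= t)%N]].

(** If the limit [L] split into two closed pieces, a continuous function equal to
    0 on one piece and to 1 on the other would take, along the walks, values
    between 1/3 and 2/3; a limit of points where it does lies in [L] and in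
    neither piece. *)
Lemma ultralimit_walk_connected (R : realType) (X : metricType R)
    (U : set_system nat) (y : nat -> nat -> X) (s t : nat -> nat) :
  UltraFilter U -> compact [set: X] ->
  (forall e, 0 < e -> U [set n | forall j, (s n <= j < t n)%N ->
     mdist (y n j) (y n j.+1) < e]) ->
  connected (ultralimit U (fun n => walk_trace (y n) (s n) (t n))).
Proof.
move=> UU cX fine; set L := ultralimit _ _ => B [p Bp] [C oC BC] [D cD BD].
have cL : closed L by exact: ultralimit_closed.
apply: contrapT => BL.
have [q [Lq nCq]] : exists q, L q /\ ~ C q.
  apply: contrapT => nq; apply: BL; rewrite BC; apply/seteqP; split=> z.
    by case.
  by move=> Lz; split=> //; apply: contrapT => nCz; apply: nq; exists z.
have cB : closed B by rewrite BD; exact: closedI.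
have cG : closed (L `&` ~` C) by apply: closedI => //; exact: open_closedC.
have BG0 : B `&` (L `&` ~` C) = set0.
  by rewrite BC -subset0 => z [[_ Cz] [_ nCz]].
have /normal_separatorP/(_ _ _ cB cG BG0) :=
  @pseudometric_normal R X.
move=> /(_ R)/(@uniform_separatorP _ R)[g [cg g01 gB gG]].
have g0 z : B z -> g z = 0 by move=> Bz; apply: (gB (g z)); exists z.
have g1 z : L z -> ~ C z -> g z = 1 by move=> Lz Cz; apply: (gG (g z)); exists z.
have Lp : L p by move: Bp; rewrite BC => -[].
have [d d0 gd] := @compact_uniform R X g (1 / 3) cX cg ltac:(lra).
have nearp : U [set n | walk_trace (y n) (s n) (t n) `&`
    g @^-1` [set r | r < 1/3] !=set0].
  apply: (Lp); apply: open_nbhs_nbhs; split; last by rewrite /= g0 //; lra.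
  by apply: open_comp; [move=> z _; exact: cg | exact: open_lt].
have nearq : U [set n | walk_trace (y n) (s n) (t n) `&`
    g @^-1` [set r | 2/3 < r] !=set0].
  apply: (Lq); apply: open_nbhs_nbhs; split; last by rewrite /= g1 //; lra.
  by apply: open_comp; [move=> z _; exact: cg | exact: open_gt].
pose midway n z := walk_trace (y n) (s n) (t n) z /\ 1/3 <= g z <= 2/3.
have mid : U [set n | exists z, midway n z].
  apply: filterS (filterI (filterI nearp nearq) (fine d d0)).
  move=> n [[[_ [[a sa <-] ga]] [_ [[b sb <-] gb]]] fn].
  have step j : (s n <= j < t n)%N -> `|g (y n j.+1) - g (y n j)| < 2/3 - 1/3.
    by move=> sj; rewrite distrC (lt_le_trans (gd _ _ (fn j sj))) //; lra.
  have c12 : 1/3 < 2/3 :> R by lra.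
  have [j sj gj] := @walk_ivt R (g \o y n) _ _ _ _ _ _ sa sb ga gb c12 step.
  by exists (y n j); split=> //; exists j.
have [z hz] : {z : nat -> X & forall n, (exists z', midway n z') -> midway n (z n)}.
  apply: (@choice _ _ (fun n z => (exists z', midway n z') -> midway n z)) => n.
  by have [[z hz]|nz] := pselect (exists z', midway n z'); [exists z | exists p].
have [l zl] := ultra_cvg_compact z UU cX.
have Ll : L l by apply: ultralimit_mem zl; apply: filterS mid => n /hz[].
have gl : 1/3 <= g l <= 2/3.
  have : closed (g @^-1` [set r | 1/3 <= r <= 2/3]).
    apply: preimage_closed => [w _|]; first exact: cg.
    rewrite (_ : mkset _ = [set r | 1/3 <= r] `&` [set r | r <= 2/3]).
      by apply: closedI; [exact: closed_ge | exact: closed_le].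
    by apply/seteqP; split=> r /= => [/andP|[-> ->]].
  move=> /closed_cvg/(_ _ _ zl); apply.
  by apply: filterS mid => n /hz[].
have [Cl|nCl] := pselect (C l).
  by move: gl; rewrite g0 ?BC //; lra.
by move: gl; rewrite g1 //; lra.
Qed.

(** * Chains *)

Section links.
Variables (T : Type) (d : seq (set T)).

Lemma link_lt_size i p : link d i p -> (i < size d)%N.
Proof. by rewrite ltnNge; apply: contraPN => id; rewrite /link nth_default. Qed.

Lemma covers_link p : covers d -> exists i, link d i p.
Proof.
move=> dT; have : [set: T] p by [].
by rewrite -dT => -[i _ ip]; exists i.
Qed.

End links.

Lemma link_mkseq (T : Type) (F : nat -> set T) m i p :
  link (mkseq F m) i p <-> (i < m)%N /\ F i p.
Proof.
split=> [ip|[im Fip]]; last by rewrite /link nth_mkseq.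
have im : (i < m)%N by have := link_lt_size ip; rewrite size_mkseq.
by move: ip; rewrite /link nth_mkseq.
Qed.

Section chains.
Variables (T : topologicalType) (d : seq (set T)).
Hypothesis dchain : is_chain d.

Lemma chain_open i : open (link d i).
Proof.
have [id|di] := ltnP i (size d); first exact: (dchain.1 (Ordinal id)).
by rewrite /link nth_default //; exact: open0.
Qed.

Lemma chain_adjacent i j p : link d i p -> link d j p ->
  (i <= j.+1)%N /\ (j <= i.+1)%N.
Proof.
move=> ip jp; have id := link_lt_size ip; have jd := link_lt_size jp.
have /(dchain.2 (Ordinal id) (Ordinal jd)).1 /= : link d i `&` link d j !=set0.
  by exists p.
lia.
Qed.

Lemma chain_meet i j : (i < size d)%N -> (j < size d)%N ->
  (i <= j.+1)%N -> (j <= i.+1)%N -> link d i `&` link d j !=set0.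
Proof.
move=> id jd ij ji; apply/(dchain.2 (Ordinal id) (Ordinal jd)) => /=; lia.
Qed.

(** Otherwise the links before [j] and the links after [j] would disconnect
    [B]. *)
Lemma chain_connected_between (B : set T) i j k p q : covers d -> connected B ->
  B p -> B q -> link d i p -> link d k q -> (i <= j <= k)%N ->
  B `&` link d j !=set0.
Proof.
move=> dT cB Bp Bq ip kq ijk; apply: contrapT => Bj.
have nBj z : B z -> ~ link d j z by move=> Bz jz; apply: Bj; exists z.
have ij : (i < j)%N.
  rewrite ltn_neqAle; apply/andP; split; last by lia.
  by apply/eqP => ij; apply: (nBj p); rewrite -?ij.
have jk : (j < k)%N.
  rewrite ltn_neqAle; apply/andP; split; last by lia.
  by apply/eqP => jk; apply: (nBj q); rewrite ?jk.
pose C := \bigcup_(t in [set t | (t < j)%N]) link d t.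
pose C' := \bigcup_(t in [set t | (j < t)%N]) link d t.
have oC : open C by apply: bigcup_open => t _; exact: chain_open.
have oC' : open C' by apply: bigcup_open => t _; exact: chain_open.
have CC' z : C z -> C' z -> False.
  move=> [t /= tj tz] [t' /= jt' tz'].
  by have := chain_adjacent tz tz'; lia.
have BCC' z : B z -> ~ C z -> C' z.
  move=> Bz nC; have [t tz] := covers_link z dT; exists t => //=.
  rewrite ltn_neqAle; apply/andP; split.
    by apply/eqP => jt; apply: (nBj z); rewrite ?jt.
  by rewrite leqNgt; apply/negP => tj; apply: nC; exists t.
have Cq : C' q by exists k.
suff BC : B `&` C = B by move: Bq; rewrite -BC => -[_ /CC'/(_ Cq)].
apply: cB; first by exists p; split=> //; exists i.
  by exists C.
exists (~` C'); first exact: open_closedC.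
apply/seteqP; split=> z [Bz hz]; split=> //; first by move=> /(CC' _ hz).
by apply: contrapT => /(BCC' _ Bz).
Qed.

End chains.

Lemma walk_crosses_level (Q : nat -> nat) (k z m q : nat) :
  (forall t, (t.+1 < m)%N -> (Q t.+1 <= (Q t).+1)%N /\ (Q t <= (Q t.+1).+1)%N) ->
  (k < m)%N -> (z < m)%N -> Q k = 0%N -> (q < Q z)%N ->
  exists i j, [/\ (i < m)%N, (j < m)%N, (i <= j.+1)%N /\ (j <= i.+1)%N,
    Q i = q & Q j = q.+1].
Proof.
move=> Q1 km zm Qk qz; have pk : (Q k <= q)%N by rewrite Qk.
have [kz|zk] := leqP k z.
  have [j' j'k [hj ej]] := @first_failure_after (fun t => Q t <= q)%N k z kz pk.
  have jz : (j' < z)%N.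
    rewrite ltn_neqAle; apply/andP; split; last by lia.
    by apply/eqP => jz; have := hj z; lia.
  exists j', j'.+1; split; [lia|lia|lia| |].
    by have := ej jz; have := hj j'; have := Q1 j'; lia.
  by have := ej jz; have := hj j'; have := Q1 j'; lia.
have [j' j'k [hj ej]] := @last_failure_before (fun t => Q t <= q)%N z k (ltnW zk) pk.
have jz : (z < j')%N.
  rewrite ltn_neqAle; apply/andP; split; last by lia.
  by apply/eqP => jz; have := hj z; lia.
have Q1' := Q1 j'.-1; have hj' := hj j'; have ej' := ej jz.
by exists j', j'.-1; rewrite prednK in Q1'; last lia; split; lia.
Qed.

Definition merge_links (T : Type) (d : seq (set T)) (Q : nat -> nat) : seq (set T) :=
  mkseq (fun q => \bigcup_(i in [set i | Q i = q]) link d i)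
        (\max_(i < size d) Q i).+1.

Lemma link_merge (T : Type) (d : seq (set T)) (Q : nat -> nat) q p :
  link (merge_links d Q) q p <-> exists2 i, Q i = q & link d i p.
Proof.
rewrite link_mkseq; split=> [[_ [i Qi ip]]|[i Qi ip]]; first by exists i.
split; last by exists i.
rewrite ltnS -Qi.
exact: (@leq_bigmax _ (fun o : 'I_(size d) => Q o) (Ordinal (link_lt_size ip))).
Qed.

Lemma merge_links_covers (T : Type) (d : seq (set T)) (Q : nat -> nat) :
  covers d -> covers (merge_links d Q).
Proof.
move=> dT; apply/seteqP; split=> // p _; have [i ip] := covers_link p dT.
have mp : link (merge_links d Q) (Q i) p by apply/link_merge; exists i.
by exists (Ordinal (link_lt_size mp)).
Qed.

Lemma merge_links_chain (T : topologicalType) (d : seq (set T)) (Q : nat -> nat) k :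
  is_chain d -> (k < size d)%N -> Q k = 0%N ->
  (forall t, (t.+1 < size d)%N -> (Q t.+1 <= (Q t).+1)%N /\ (Q t <= (Q t.+1).+1)%N) ->
  is_chain (merge_links d Q).
Proof.
move=> dc kd Qk Q1.
have [z zd Qz] : exists2 z, (z < size d)%N & (\max_(i < size d) Q i)%N = Q z.
  have [|z _ ->] := @eq_bigmax_cond _ xpredT (fun i : 'I_(size d) => Q i).
    by rewrite card_ord (leq_ltn_trans _ kd).
  by exists z.
split=> [[q qm]|[q qm] [q' qm']] /=.
  rewrite /link nth_mkseq; last by rewrite size_mkseq in qm.
  by apply: bigcup_open => i _; exact: chain_open.
rewrite size_mkseq Qz in qm qm'.
split=> [[p [/link_merge[i <- ip] /link_merge[j <- jp]]]|qq'].
  have := chain_adjacent dc ip jp.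
  case: (ltngtP i j) => ij; last by rewrite ij subrr.
    have := Q1 i; have := link_lt_size jp.
    move=> jd Qi [_ ji]; have ji' : j = i.+1 by lia.
    by subst j; have := Qi jd; lia.
  have := Q1 j; have := link_lt_size ip.
  move=> id Qj [ji _]; have ji' : i = j.+1 by lia.
  by subst i; have := Qj id; lia.
have next r : (r < Q z)%N ->
    link (merge_links d Q) r `&` link (merge_links d Q) r.+1 !=set0.
  move=> /(walk_crosses_level Q1 kd zd Qk)[i [j [id jd [ij ji] Qi Qj]]].
  have [p [ip jp]] := chain_meet dc id jd ij ji.
  by exists p; split; apply/link_merge; [exists i|exists j].
have [qq|[qq|qq]] : q = q' \/ q' = q.+1 \/ q = q'.+1 by lia.
- subst q'; rewrite setIid; case: q qm {qm' qq'} => [_|r rm].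
    have [p [kp _]] := chain_meet dc kd kd (leqnSn _) (leqnSn _).
    by exists p; apply/link_merge; exists k.
  by have [p [_ rp]] := next r rm; exists p.
- by subst q'; apply: next.
- by subst q; rewrite setIC; apply: next.
Qed.

Section mesh.
Variables (R : realType) (X : metricType R).
Implicit Types (d : seq (set X)) (e : R).

Lemma diam_le_mesh d i : (i < size d)%N -> (diam (link d i) <= mesh d)%E.
Proof.
rewrite /mesh; elim: d i => [//|A d IHd] [|i] id; rewrite big_cons le_max.
  by rewrite /link /= lexx.
by apply/orP; right; exact: IHd.
Qed.

Lemma mesh_lt_dist d e i p q : (mesh d < e%:E)%E -> link d i p -> link d i q ->
  mdist p q < e.
Proof.
move=> de ip iq; rewrite -lte_fin; apply: le_lt_trans de.
apply: le_trans (diam_le_mesh (link_lt_size ip)).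
by apply: ereal_sup_ubound; exists (p, q).
Qed.

Lemma mesh_le d e : 0 <= e ->
  (forall i p q, link d i p -> link d i q -> mdist p q <= e) ->
  (mesh d <= e%:E)%E.
Proof.
move=> e0; rewrite /mesh; elim: d => [|A d IHd] de; first by rewrite big_nil lee_fin.
rewrite big_cons ge_max; apply/andP; split.
  by apply: ge_ereal_sup => _ [[p q] [/= Ap Aq] <-]; rewrite lee_fin; exact: (de 0%N).
by apply: IHd => i p q ip iq; exact: (de i.+1).
Qed.

Lemma mesh_eventually (D : nat -> seq (set X)) e :
  mesh (D n) @[n --> \oo] --> 0%E -> 0 < e ->
  \forall n \near \oo, (mesh (D n) < e%:E)%E.
Proof.
move=> D0 e0; apply: (D0 [set y | (y < e%:E)%E]); apply: open_nbhs_nbhs.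
by split; [exact: open_ereal_lt_ereal | rewrite /= lte_fin].
Qed.

Lemma chain_dist d e i m p q : is_chain d -> (mesh d < e%:E)%E ->
  link d i p -> link d (i + m) q -> mdist p q < m.+1%:R * e.
Proof.
move=> dc de; elim: m q => [|m IHm] q ip iq.
  by rewrite addn0 in iq; rewrite mul1r; exact: mesh_lt_dist de ip iq.
rewrite addnS in iq; have id := link_lt_size iq.
have [z [iz iz']] := chain_meet dc (ltnW id) id (ltnW (leqnSn _)) (leqnn _).
rewrite (le_lt_trans (metric_triangle p z q)) // -[m.+2]addn1 natrD mulrDl mul1r.
by rewrite ltrD ?IHm //; exact: mesh_lt_dist de iz' iq.
Qed.

End mesh.

(** * Extremal points of ultrafilter orders *)

Section ultrafilter_orders.
Variables (R : realType) (X : metricType R).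
Implicit Types (D : nat -> seq (set X)) (U : set_system nat).

Lemma chain_leP (d : seq (set X)) p q :
  chain_le d p q <-> exists i j, [/\ (i <= j)%N, link d i p & link d j q].
Proof.
split=> [[i [j [ij ip jq]]]|[i [j [ij ip jq]]]]; first by exists i, j.
by exists (Ordinal (link_lt_size ip)), (Ordinal (link_lt_size jq)).
Qed.

Lemma mesh_ultra D U e : vanishing_chain_covers D -> UltraFilter U ->
  nonprincipal U -> 0 < e -> U [set n | (mesh (D n) < e%:E)%E].
Proof.
move=> [_ D0] UU npU e0; apply: nonprincipal_eventually => //.
exact: mesh_eventually.
Qed.

Lemma closed_ball_avoid (B : set X) (a : X) : closed B -> ~ B a ->
  exists2 r : R, 0 < r & forall z, mdist a z < r -> ~ B z.
Proof.
move=> cB nBa; have /nbhs_ballP[r /= r0 rB] : nbhs a (~` B).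
  by apply: open_nbhs_nbhs; split=> //; exact: closed_openC.
by exists r => // z az; apply: rB; rewrite ballEmdist.
Qed.

(** The links containing [a] miss [B] and the links containing [b] miss [A].  If
    [a] and [b] were on the same side of [x], the connected set going from [x] to
    the farther point would meet a link of the nearer one. *)
Lemma chain_between (d : seq (set X)) (r : R) (A B : set X) (a b x : X) :
  is_chain d -> covers d -> (mesh d < r%:E)%E ->
  connected A -> connected B -> A a -> A x -> B b -> B x ->
  (forall z, mdist a z < r -> ~ B z) -> (forall z, mdist b z < r -> ~ A z) ->
  (chain_le d a x /\ chain_le d x b) \/ (chain_le d b x /\ chain_le d x a).
Proof.
move=> dc dT dr cA cB Aa Ax Bb Bx aB bA.
have [i ai] := covers_link a dT; have [j bj] := covers_link b dT.
have [k xk] := covers_link x dT.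
have miss_a i' j' p q : link d i' p -> link d j' q -> B p -> B q ->
    (i' <= i <= j')%N -> False.
  move=> pi qj Bp Bq ij.
  have [z [Bz zi]] := chain_connected_between dc dT cB Bp Bq pi qj ij.
  exact: aB (mesh_lt_dist dr ai zi) Bz.
have miss_b i' j' p q : link d i' p -> link d j' q -> A p -> A q ->
    (i' <= j <= j')%N -> False.
  move=> pi qj Ap Aq ij.
  have [z [Az zj]] := chain_connected_between dc dT cA Ap Aq pi qj ij.
  exact: bA (mesh_lt_dist dr bj zj) Az.
have [ik|ki] := leqP i k; have [jk|kj] := leqP j k.
- exfalso; have [ij|ji] := leqP i j.
    by apply: (miss_b i k a x ai xk Aa Ax); rewrite ij jk.
  by apply: (miss_a j k b x bj xk Bb Bx); rewrite ik ltnW.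
- left; split; apply/chain_leP; first by exists i, k.
  by exists k, j; split=> //; exact: ltnW.
- right; split; apply/chain_leP; first by exists j, k.
  by exists k, i; split=> //; exact: ltnW.
- exfalso; have [ij|ji] := leqP i j.
    by apply: (miss_a k j x b xk bj Bx Bb); rewrite ij ltnW.
  by apply: (miss_b k i x a xk ai Ax Aa); rewrite (ltnW kj) (ltnW ji).
Qed.

(** Points [a] of [A] outside [B] and [b] of [B] outside [A] would lie on either
    side of [x]; the ultrafilter decides on which, and in both cases [x] has a
    point strictly below it and one strictly above it. *)
Lemma extremal_comparable D U x (A B : set X) :
  vanishing_chain_covers D -> UltraFilter U -> nonprincipal U ->
  minimal (ultra_le D U) x \/ maximal (ultra_le D U) x ->
  closed A -> connected A -> A x -> closed B -> connected B -> B x ->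
  A `<=` B \/ B `<=` A.
Proof.
move=> vD UU npU ext clA cA Ax clB cB Bx; apply: contrapT.
move=> /not_orP[/existsNP[a /not_implyP[Aa nBa]] /existsNP[b /not_implyP[Bb nAb]]].
have [r r0 ra] := closed_ball_avoid clB nBa.
have [s s0 sb] := closed_ball_avoid clA nAb.
have btw : U ([set n | chain_le (D n) a x /\ chain_le (D n) x b] `|`
              [set n | chain_le (D n) b x /\ chain_le (D n) x a]).
  apply: filterS (filterI (mesh_ultra vD UU npU r0) (mesh_ultra vD UU npU s0)).
  move=> n [/= nr ns]; have [dc dT] := vD.1 n.
  have nm : (mesh (D n) < (Num.min r s)%:E)%E by rewrite EFin_min lt_min nr ns.
  have := chain_between dc dT nm cA cB Aa Ax Bb Bx; apply=> z zm.
    by apply: ra; apply: lt_le_trans zm _; rewrite ge_min lexx.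
  by apply: sb; apply: lt_le_trans zm _; rewrite ge_min lexx orbT.
have ax : a <> x by move=> ax; apply: nBa; rewrite ax.
have bx : b <> x by move=> bx; apply: nAb; rewrite bx.
have [Uab|Uab] := in_ultra_setVsetC
  [set n | chain_le (D n) a x /\ chain_le (D n) x b] UU.
  have ax' : ultra_le D U a x by apply: filterS Uab => n [].
  have xb' : ultra_le D U x b by apply: filterS Uab => n [].
  by case: ext => ext; [exact: ax (ext _ ax') | exact: bx (ext _ xb')].
have Uba : U [set n | chain_le (D n) b x /\ chain_le (D n) x a].
  by apply: filterS2 btw Uab => n [].
have bx' : ultra_le D U b x by apply: filterS Uba => n [].
have xa' : ultra_le D U x a by apply: filterS Uba => n [].
by case: ext => ext; [exact: bx (ext _ bx') | exact: ax (ext _ xa')].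
Qed.

Lemma nonprincipal_exists :
  exists U : set_system nat, UltraFilter U /\ nonprincipal U.
Proof.
have [U [UU ooU]] := ultraFilterLemma eventually_filter.
exists U; split=> // t Ut.
have : U [set n | (t < n)%N] by apply: ooU; exists t.+1.
by rewrite Ut => /principal_filterP /=; rewrite ltnn.
Qed.

Lemma endpoint_minimal x : endpoint x ->
  exists r : X -> X -> Prop, ultrafilter_order r /\ minimal r x.
Proof.
move=> ex; have e0 n : 0 < n.+1%:R^-1 :> R by rewrite invr_gt0 ltr0n.
have [D hD] : {D : nat -> seq (set X) & forall n, [/\ eps_chain n.+1%:R^-1 (D n),
    covers (D n) & forall i : 'I_(size (D n)), link (D n) i x <-> i = 0%N :> nat]}.
  exact: (@choice _ _ (fun n d => [/\ eps_chain n.+1%:R^-1 d, covers d &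
    forall i : 'I_(size d), link d i x <-> i = 0%N :> nat]) (fun n => ex _ (e0 n))).
have vD : vanishing_chain_covers D.
  split=> [n|]; first by have [[]] := hD n.
  apply: (@squeeze_cvge _ _ _ _ (cst 0%E) _ (fun n => (n.+1%:R^-1)%:E)).
  - apply: nearW => n; rewrite /cst bigmax_ge_id /=.
    by have [[_ /ltW]] := hD n.
  - exact: cvg_cst.
  - exact: cvg_comp cvg_harmonic _.
have [U [UU npU]] := nonprincipal_exists.
exists (ultra_le D U); split; first by exists D, U.
move=> y yx; apply: contrapT => /eqP; rewrite -mdist_gt0 => r0.
have [n [yxn]] := filter_ex (filterI yx (mesh_ultra vD UU npU r0)).
move: yxn => [i [j [ij iy jx]]] /= nr; have [_ _ D0] := hD n.
have j0 := (D0 j).1 jx; rewrite j0 leqn0 in ij; rewrite (eqP ij) in iy.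
by rewrite j0 in jx; have := mesh_lt_dist nr iy jx; rewrite ltxx.
Qed.

Lemma absolute_endpoint_extremal D U x : absolute_endpoint x ->
  vanishing_chain_covers D -> UltraFilter U -> nonprincipal U ->
  minimal (ultra_le D U) x \/ maximal (ultra_le D U) x.
Proof.
move=> ax vD UU npU; apply: contrapT.
move=> /not_orP[/existsNP[y /not_implyP[yx /eqP nyx]]].
move=> /existsNP[z /not_implyP[xz /eqP nzx]].
rewrite -mdist_gt0 in nyx; rewrite -mdist_gt0 in nzx.
have m0 : 0 < Num.min (mdist y x) (mdist z x) by rewrite lt_min nyx nzx.
have [delta delta0 hdelta] := ax _ m0.
have [n [[/= yxn xzn] [/= nd nm]]] := filter_ex (filterI (filterI yx xz)
  (filterI (mesh_ultra vD UU npU delta0) (mesh_ultra vD UU npU m0))).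
have [dc dT] := vD.1 n.
move: yxn => [i [j [ij iy jx]]]; move: xzn => [j' [i' [ji' jx' iz']]].
have far w : mdist w x = mdist y x \/ mdist w x = mdist z x ->
    ~ ball x (Num.min (mdist y x) (mdist z x)) w.
  rewrite ballEmdist /= metric_sym lt_min => -[->|->] /andP[]; last by rewrite ltxx.
  by rewrite ltxx.
(* The links [j] and [j'] containing [x] that compare it with [y] and with [z]
   may differ; if the link [i'] of [z] comes before [j], then [i' = j'], and [z]
   shares a link with [x]. *)
have [sub|sub] := hdelta (D n) (conj dc nd) dT j jx.
  by apply: (far y); [left | apply: sub; exists i].
have [ji'j|i'j] := leqP j i'.
  by apply: (far z); [right | apply: sub; exists i'].
have i'j' : i' = j' :> nat by have [] := chain_adjacent dc jx jx'; lia.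
rewrite i'j' in iz'; apply: (far z); first by right.
by rewrite ballEmdist /=; exact: mesh_lt_dist nm jx' iz'.
Qed.

End ultrafilter_orders.

(** * A coordinate along a chain and its rounding *)

(** Bounds the coordinate of a point of the link [j], at which only the summands
    [j] and [j.+1] are undetermined. *)
Lemma sum_step_profile (R : realType) (g : nat -> R) (j n : nat) :
  (forall i, 0 <= g i <= 1) -> (forall i, (i < j)%N -> g i = 1) ->
  (forall i, (j.+2 <= i)%N -> g i = 0) ->
  (minn n j)%:R <= \sum_(i < n) g i <= (minn n j.+2)%:R.
Proof.
move=> g01 g1 g0; elim: n => [|n IHn]; first by rewrite big_ord0 !min0n lexx.
rewrite big_ord_recr /=; move: IHn (g01 n).
have Sn : n.+1%:R = n%:R + 1 :> R by rewrite -addn1 natrD.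
have [nj|jn] := ltnP n j.
  have -> : minn n j.+2 = n by lia.
  have -> : minn n.+1 j = n.+1 by lia.
  have -> : minn n.+1 j.+2 = n.+1 by lia.
  by rewrite g1 // Sn; lra.
have -> : minn n.+1 j = j by lia.
have [nj|jn'] := ltnP n j.+2.
  have -> : minn n.+1 j.+2 = n.+1 by lia.
  by rewrite Sn; lra.
have -> : minn n.+1 j.+2 = j.+2 by lia.
by rewrite g0 //; lra.
Qed.

(** A chain maps its space to the line: [u] is the sum of Urysohn functions
    [g i] separating the points lying only in links before [i] from the points
    lying only in links from [i] on.  It takes on the link [j] values between [j]
    and [j + 2]. *)
Lemma chain_coordinate (R : realType) (X : metricType R) (d : seq (set X)) (e : R) :
  is_chain d -> covers d -> (mesh d < e%:E)%E ->
  exists2 u : X -> R, continuous u &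
    forall p q, `|u p - u q| <= 3 -> mdist p q < 6 * e.
Proof.
move=> dc dT de.
pose lo i := ~` \bigcup_(t in [set t | (i <= t)%N]) link d t.
pose hi i := ~` \bigcup_(t in [set t | (t < i)%N]) link d t.
have [g hg] : {g : nat -> X -> R & forall i, [/\ continuous (g i),
    range (g i) `<=` `[0, 1], g i @` lo i `<=` [set 0] & g i @` hi i `<=` [set 1]]}.
  apply: (@choice _ _ (fun i (g : X -> R) => [/\ continuous g,
    range g `<=` `[0, 1], g @` lo i `<=` [set 0] & g @` hi i `<=` [set 1]])) => i.
  have clo : closed (lo i).
    by apply: open_closedC; apply: bigcup_open => t _; exact: chain_open.
  have chi : closed (hi i).
    by apply: open_closedC; apply: bigcup_open => t _; exact: chain_open.
  have lh0 : lo i `&` hi i = set0.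
    rewrite -subset0 => z [loz hiz]; have [t tz] := covers_link z dT.
    by have [it|ti] := leqP i t; [apply: loz | apply: hiz]; exists t.
  have /normal_separatorP := @pseudometric_normal R X.
  by move=> /(_ R _ _ clo chi lh0)/(@uniform_separatorP _ R).
pose u z := \sum_(i < size d) g i z.
have uj z j : link d j z -> j%:R <= u z <= j.+2%:R.
  move=> jz; have jd := link_lt_size jz.
  have /andP[u1 u2] : (minn (size d) j)%:R <= u z <= (minn (size d) j.+2)%:R.
    apply: (@sum_step_profile _ (fun i => g i z)) => i; have [_ g01 g0 g1] := hg i.
    - by have /= := g01 (g i z); rewrite in_itv /=; apply; exists z.
    - move=> ij; apply: (g1 (g i z)); exists z => // -[t /= ti tz].
      by have [] := chain_adjacent dc jz tz; lia.
    - move=> ji; apply: (g0 (g i z)); exists z => // -[t /= ti tz].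
      by have [] := chain_adjacent dc jz tz; lia.
  rewrite (minn_idPr (ltnW jd)) in u1; rewrite u1 /=.
  by apply: le_trans u2 _; rewrite ler_nat geq_minr.
exists u.
  suff cs n : continuous (fun z => \sum_(i < n) g i z) by exact: cs.
  elim: n => [|n IHn].
    rewrite (_ : (fun _ => _) = cst 0); first by move=> z; exact: cvg_cst.
    by apply/funext => z; rewrite big_ord0.
  rewrite (_ : (fun _ => _) = (fun z => \sum_(i < n) g i z) \+ g n).
    by move=> z; apply: cvgD; [exact: IHn | have [cg _ _ _] := hg n; exact: cg].
  by apply/funext => z; rewrite big_ord_recr.
suff near p q i j : link d i p -> link d j q -> (i <= j)%N -> `|u p - u q| <= 3 ->
    mdist p q < 6 * e.
  move=> p q; have [i ip] := covers_link p dT; have [j jq] := covers_link q dT.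
  have [ij|/ltnW ji] := leqP i j; first exact: near ip jq ij.
  by rewrite distrC metric_sym; exact: near jq ip ji.
move=> ip jq ij upq; have up := uj p i ip; have uq := uj q j jq.
have ji5 : (j <= i + 5)%N.
  rewrite -(ler_nat R) natrD.
  move: up uq upq; rewrite -[i.+2]addn2 natrD ler_norml; lra.
rewrite -(subnKC ij) in jq.
apply: lt_le_trans (chain_dist dc de ip jq) _.
have e0 : 0 < e by have := mesh_lt_dist de ip ip; rewrite mdistxx.
rewrite ler_wpM2r ?(ltW e0) // ler_nat; lia.
Qed.


(** The number of the interval containing [r], counted from 0, when the line is
    cut at the points [b + m] and [- (a + m)], for [m] in [nat].  The floors are
    used on either side of 0 because [a] and [b] are unrelated. *)
Definition block (R : realType) (a b r : R) : int :=
  if 0 <= r then Num.floor (r - b) + 1 else - (Num.floor (- r - a) + 1).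

Lemma block0 (R : realType) (a b : R) : 0 < a < 1 -> 0 < b < 1 ->
  block a b 0 = 0.
Proof.
move=> /andP[a0 a1] /andP[b0 b1].
rewrite /block lexx; have : Num.floor (0 - b) = -1; last by move=> ->.
apply/eqP; rewrite floor_eq addNr mulr0z mulrN1z sub0r.
lra.
Qed.

Lemma block_ge (R : realType) (a b : R) (m : nat) r : 0 < a < 1 -> 0 < b < 1 ->
  (m.+1%:Z <= block a b r) = (b + m%:R <= r).
Proof.
move=> /andP[a0 a1] /andP[b0 b1]; have bm0 : 0 < b + m%:R by have := ler0n R m; lra.
rewrite /block; case: ifPn => r0.
  rewrite -[m.+1]addn1 PoszD lerD2r floor_ge_int -pmulrn; apply/idP/idP; lra.
rewrite -ltNge in r0.
have : 0 <= Num.floor (- r - a) + 1.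
  by rewrite -lerBlDr sub0r floor_ge_int mulrN1z; lra.
by move=> f0; apply/idP/idP => h; exfalso; [lia | lra].
Qed.

Lemma block_le (R : realType) (a b : R) (m : nat) r : 0 < a < 1 -> 0 < b < 1 ->
  (block a b r <= - m.+1%:Z) = (r <= - (a + m%:R)).
Proof.
move=> /andP[a0 a1] /andP[b0 b1]; have am0 : 0 < a + m%:R by have := ler0n R m; lra.
rewrite /block; case: ifPn => r0.
  have : 0 <= Num.floor (r - b) + 1.
    by rewrite -lerBlDr sub0r floor_ge_int mulrN1z; lra.
  by move=> f0; apply/idP/idP => h; exfalso; [lia | lra].
rewrite lerN2 -[m.+1]addn1 PoszD lerD2r floor_ge_int -pmulrn; apply/idP/idP; lra.
Qed.

(** The second bound forbids jumping over the interval around 0, of length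
    [a + b], which may be short. *)
Lemma block_near (R : realType) (a b r s : R) : 0 < a < 1 -> 0 < b < 1 ->
  `|r - s| < 1 -> `|r - s| < a + b -> `|block a b r - block a b s| <= 1.
Proof.
move=> /andP[a0 a1] /andP[b0 b1] h1 h2.
have same (p q : R) : `|p - q| < 1 -> `|Num.floor p - Num.floor q| <= 1.
  move=> pq; have := floor_itv p; have := floor_itv q; rewrite !intrD.
  set P := Num.floor p; set Q := Num.floor q => Qq Pp.
  have : ((P - Q)%:~R < 2%:~R :> R) by rewrite intrB; move: pq; rewrite ltr_norml; lra.
  have : ((- 2)%:~R < (P - Q)%:~R :> R) by rewrite intrB; move: pq; rewrite ltr_norml; lra.
  by rewrite !ltr_int; lia.
have opp (p q : R) : 0 <= p -> q < 0 -> p - q < a + b ->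
    `|Num.floor (p - b) + 1 - - (Num.floor (- q - a) + 1)| <= 1.
  move=> p0 q0 pq; have := floor_itv (p - b); have := floor_itv (- q - a).
  rewrite !intrD; set P := Num.floor (p - b); set Q := Num.floor (- q - a) => Qq Pp.
  have : ((P + Q)%:~R < 0%:~R :> R) by rewrite intrD; lra.
  have : ((- 2)%:~R < P%:~R :> R) by lra.
  have : ((- 2)%:~R < Q%:~R :> R) by lra.
  by rewrite !ltr_int; lia.
rewrite /block; case: ifPn => r0; case: ifPn => s0.
- have := same (r - b) (s - b); rewrite (_ : r - b - _ = r - s); last by lra.
  by move=> /(_ h1); lia.
- by apply: opp; rewrite ?ltNge //; move: h2; rewrite ltr_norml; lra.
- rewrite distrC; apply: opp; rewrite ?ltNge //; move: h2; rewrite ltr_norml; lra.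
- have := same (- r - a) (- s - a); rewrite (_ : - r - a - _ = s - r); last by lra.
  by rewrite distrC => /(_ h1); lia.
Qed.

Lemma block_width (R : realType) (a b r s : R) : 0 < a < 1 -> 0 < b < 1 ->
  `|block a b r - block a b s| <= 1 -> `|r - s| <= 3.
Proof.
move=> /andP[a0 a1] /andP[b0 b1].
have fl (p q : R) : Num.floor p - Num.floor q <= 1 -> p - q < 2.
  have := floor_itv p; have := floor_itv q; rewrite !intrD => hq hp.
  by rewrite -(ler_int R) intrB; lra.
have opp (p q : R) : 0 <= p -> q < 0 ->
    Num.floor (p - b) + 1 - - (Num.floor (- q - a) + 1) <= 1 -> p - q < 3.
  have := floor_itv (p - b); have := floor_itv (- q - a); rewrite !intrD => hq hp p0 q0.
  by rewrite -(ler_int R) opprK !intrD; lra.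
rewrite /block; case: ifPn => r0; case: ifPn => s0 h.
- have h1 : r - b - (s - b) < 2 by apply: fl; lia.
  have h2 : s - b - (r - b) < 2 by apply: fl; lia.
  by rewrite ler_norml; lra.
- rewrite -ltNge in s0; have h1 : r - s < 3 by apply: opp => //; lia.
  by rewrite ler_norml; lra.
- rewrite -ltNge in r0; have h1 : s - r < 3 by apply: opp => //; lia.
  by rewrite ler_norml; lra.
- have h1 : - r - a - (- s - a) < 2 by apply: fl; lia.
  have h2 : - s - a - (- r - a) < 2 by apply: fl; lia.
  by rewrite ler_norml; lra.
Qed.

(** * Walks sampled along fine chains are foldable *)

Lemma ultra_int_constant (T : Type) (U : set_system T) (h : T -> int) (c : int) :
  UltraFilter U -> U [set n | `|h n - c| <= 1] -> exists m, U [set n | h n = m].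
Proof.
move=> UU hc.
have [U0|U0] := in_ultra_setVsetC [set n | h n = c] UU; first by exists c.
have [U1|U1] := in_ultra_setVsetC [set n | h n = c + 1] UU; first by exists (c + 1).
exists (c - 1); apply: filterS (filterI hc (filterI U0 U1)) => n [/= h1 [h2 h3]].
by move/eqP: h2; move/eqP: h3; lia.
Qed.

Lemma limit_continuum (R : realType) (X : metricType R) (U : set_system nat)
    (y : nat -> nat -> X) (s t k z : nat -> nat) (x : X) (K K' : set X) :
  UltraFilter U -> compact [set: X] -> closed K -> closed K' ->
  (forall n, y n (k n) = x) ->
  (forall e, 0 < e -> U [set n | forall j, (s n <= j < t n)%N ->
     mdist (y n j) (y n j.+1) < e]) ->
  U [set n | (s n <= k n <= t n)%N] ->
  U [set n | forall j, (s n <= j <= t n)%N -> K (y n j)] ->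
  U [set n | (s n <= z n <= t n)%N /\ K' (y n (z n))] ->
  exists A : set X, [/\ closed A, connected A, A x, A `<=` K
    & exists2 c, A c & K' c].
Proof.
move=> UU cX cK cK' yk fine kst yK yK'.
pose L := ultralimit U (fun n => walk_trace (y n) (s n) (t n)).
have [c yc] := ultra_cvg_compact (fun n => y n (z n)) UU cX.
exists L; split.
- exact: ultralimit_closed.
- exact: ultralimit_walk_connected.
- apply: (@ultralimit_mem _ _ _ UU _ (fun n => y n (k n))).
    by apply: filterS kst => n kn; exists (k n).
  by under eq_fun do rewrite yk; exact: cvg_cst.
- apply: ultralimit_sub => //; apply: filterS yK => n yn _ [j sj <-].
  exact: yn.
- exists c.
    by apply: ultralimit_mem yc; apply: filterS yK' => n [zn _]; exists (z n).
  by apply: (closed_cvg _ cK' _ _ yc); apply: filterS yK' => n [].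
Qed.

(** What is left in the limit of walks whose two halves meet [v] and [w] in
    opposite orders. *)
Definition crossing_continua (R : realType) (X : topologicalType) (u : X -> R)
    (x : X) (v w : R) : Prop :=
  exists A B : set X,
    [/\ closed A, connected A, A x, A `<=` [set z | u z <= w]
      & exists2 c, A c & u c <= v] /\
    [/\ closed B, connected B, B x, B `<=` [set z | v <= u z]
      & exists2 c, B c & w <= u c].

Section noncrossing_limit.
Variables (R : realType) (X : metricType R) (U : set_system nat) (x : X).
Variables (u : X -> R) (a b : R) (y : nat -> nat -> X) (k M : nat -> nat).
Hypotheses (UU : UltraFilter U) (cX : compact [set: X]) (cu : continuous u).
Hypotheses (ux : u x = 0) (a01 : 0 < a < 1) (b01 : 0 < b < 1).
Hypothesis generic :
  forall i j : nat, ~ crossing_continua u x (- (a + i%:R)) (b + j%:R).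
Hypothesis yk : forall n, y n (k n) = x.
Hypothesis kM : forall n, (k n <= M n)%N.
Hypothesis fine : forall e, 0 < e ->
  U [set n | forall j, (j < M n)%N -> mdist (y n j) (y n j.+1) < e].
Let f n t := block a b (u (y n t)).

(** The sampled values of [u] converge, so their roundings eventually take at
    most three values, among which the ultrafilter chooses. *)
Lemma block_eventually_constant (z : nat -> nat) : exists m, U [set n | f n (z n) = m].
Proof.
have [c yc] := ultra_cvg_compact (fun n => y n (z n)) UU cX.
have [a0 b0] : 0 < a /\ 0 < b by move: a01 b01 => /andP[-> _] /andP[-> _].
have m0 : 0 < Num.min 1 (a + b) by rewrite lt_min ltr01 addr_gt0.
apply: (@ultra_int_constant _ _ _ (block a b (u c)) UU).
have uyc : u (y n (z n)) @[n --> U] --> u c by apply: continuous_cvg => //; exact: cu.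
apply: filterS ((cvgrPdist_lt _ _).1 uyc _ m0) => n /=; rewrite lt_min => /andP[h1 h2].
by rewrite distrC; apply: block_near.
Qed.

(** The segment from [s] to [t] reaches the low value [f (z)] staying below
    [f (z')], and the segment from [s'] to [t'] reaches the high value [f (z')]
    staying above [f (z)].  Both values are constant along the ultrafilter, and the
    ultralimits of the two segments are crossing continua for the corresponding
    thresholds. *)
Lemma no_limit_crossing (s t s' t' z z' : nat -> nat) :
  U [set n | [/\ (s n <= k n <= t n)%N, (s n <= z n <= t n)%N & (t n <= M n)%N]] ->
  U [set n | [/\ (s' n <= k n <= t' n)%N, (s' n <= z' n <= t' n)%N & (t' n <= M n)%N]] ->
  U [set n | forall j, (s n <= j <= t n)%N -> f n j < f n (z' n)] ->
  U [set n | forall j, (s' n <= j <= t' n)%N -> f n (z n) < f n j] ->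
  False.
Proof.
move=> st st' fw fv.
have [m Um] := block_eventually_constant z.
have [m' Um'] := block_eventually_constant z'.
have [n [[[kn _ _] [kn' _ _]] [[fwn fvn] [mn m'n]]]] :=
  filter_ex (filterI (filterI st st') (filterI (filterI fw fv) (filterI Um Um'))).
have fk : f n (k n) = 0 by rewrite /f yk ux block0.
have m_lt0 : m < 0 by have := fvn _ kn'; rewrite fk mn.
have m'_gt0 : 0 < m' by have := fwn _ kn; rewrite fk m'n.
have [p mp] : exists p : nat, m = - p.+1%:Z by exists (absz m).-1; lia.
have [q mq] : exists q : nat, m' = q.+1%:Z by exists (absz m').-1; lia.
have ule r : closed [set c | u c <= r].
  apply: (@preimage_closed _ _ u [set r' | r' <= r]); last exact: closed_le.
  by move=> c _; exact: cu.
have uge r : closed [set c | r <= u c].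
  apply: (@preimage_closed _ _ u [set r' | r <= r']); last exact: closed_ge.
  by move=> c _; exact: cu.
have fine_on (s1 t1 : nat -> nat) : U [set n | (t1 n <= M n)%N] ->
    forall e, 0 < e -> U [set n | forall j, (s1 n <= j < t1 n)%N ->
      mdist (y n j) (y n j.+1) < e].
  move=> tM e e0; apply: filterS2 tM (fine e0) => n1 /= tM h j /andP[_ jt].
  exact/h/(leq_trans jt).
apply: (generic (i := p) (j := q)).
have [||||A hA] := @limit_continuum R X U y s t k z x
  [set c | u c <= b + q%:R] [set c | u c <= - (a + p%:R)] UU cX (ule _) (ule _) yk.
- by apply: fine_on; apply: filterS st => n1 [].
- by apply: filterS st => n1 [].
- apply: filterS2 fw Um' => n1 h m'n1 j sj /=; have := h j sj.
  by rewrite m'n1 mq ltNge block_ge // -ltNge => /ltW.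
- apply: filterS2 st Um => n1 [_ zn1 _] mn1; split=> //=.
  by rewrite -(block_le _ _ a01 b01) -mp -mn1.
have [||||B hB] := @limit_continuum R X U y s' t' k z' x
  [set c | - (a + p%:R) <= u c] [set c | b + q%:R <= u c] UU cX (uge _) (uge _) yk.
- by apply: fine_on; apply: filterS st' => n1 [].
- by apply: filterS st' => n1 [].
- apply: filterS2 fv Um => n1 h mn1 j sj /=; have := h j sj.
  by rewrite mn1 mp ltNge block_le // -ltNge => /ltW.
- apply: filterS2 st' Um' => n1 [_ zn1 _] mn1; split=> //=.
  by rewrite -(block_ge _ _ a01 b01) -mq -mn1.
by exists A, B.
Qed.

Lemma crossing_indices (g : nat -> nat -> int) :
  ~ U [set n | noncrossing (k n) (M n) (g n)] ->
  exists i j : nat -> nat,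
    [/\ U [set n | (i n <= k n <= j n)%N /\ (j n <= M n)%N],
        U [set n | forall t, (i n <= t <= k n)%N -> g n t < g n (j n)]
      & U [set n | forall t, (k n <= t <= j n)%N -> g n (i n) < g n t]].
Proof.
move=> nU; have [//|cU] := in_ultra_setVsetC [set n | noncrossing (k n) (M n) (g n)] UU.
pose bad n (p : nat * nat) := [/\ (p.1 <= k n <= p.2)%N /\ (p.2 <= M n)%N,
  (forall t, (p.1 <= t <= k n)%N -> g n t < g n p.2) &
  (forall t, (k n <= t <= p.2)%N -> g n p.1 < g n t)].
have [p hp] : {p : nat -> nat * nat & forall n, (exists q, bad n q) -> bad n (p n)}.
  apply: (@choice _ _ (fun n p => (exists q, bad n q) -> bad n p)) => n.
  by have [[q hq]|nq] := pselect (exists q, bad n q); [exists q | exists (0%N, 0%N)].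
have Up : U [set n | bad n (p n)].
  apply: filterS cU => n nc; apply: hp; apply: contrapT => nbad; apply: nc.
  by move=> i j ikj jM h1 h2; apply: nbad; exists (i, j).
by exists (fst \o p), (snd \o p); split; apply: filterS Up => n [].
Qed.

Lemma eventually_noncrossing : U [set n | noncrossing (k n) (M n) (f n)].
Proof.
apply: contrapT => /crossing_indices[i [j [Uij Ui Uj]]].
apply: (@no_limit_crossing i k k j i j) => //.
- by apply: filterS Uij => n [/andP[ik kj] jM]; split; rewrite ?ik ?leqnn ?kM.
- by apply: filterS Uij => n [/andP[ik kj] jM]; split; rewrite ?kj ?leqnn.
Qed.

Lemma eventually_noncrossing_opp :
  U [set n | noncrossing (k n) (M n) (fun t => - f n t)].
Proof.
apply: contrapT => /crossing_indices[i [j [Uij Ui Uj]]].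
apply: (@no_limit_crossing k j i k j i).
- by apply: filterS Uij => n [/andP[ik kj] jM]; split; rewrite ?kj ?leqnn.
- by apply: filterS Uij => n [/andP[ik kj] jM]; split; rewrite ?ik ?leqnn ?kM.
- by apply: filterS Uj => n h t /h; rewrite ltrN2.
- by apply: filterS Ui => n h t /h; rewrite ltrN2.
Qed.

Lemma eventually_steps1 : U [set n | steps1 (M n) (f n)].
Proof.
have [a0 b0] : 0 < a /\ 0 < b by move: a01 b01 => /andP[-> _] /andP[-> _].
have m0 : 0 < Num.min 1 (a + b) by rewrite lt_min ltr01 addr_gt0.
have [d d0 ud] := compact_uniform cX cu m0.
apply: filterS (fine d0) => n h t tM.
have := ud _ _ (h t tM); rewrite lt_min distrC => /andP[h1 h2].
exact: block_near.
Qed.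

End noncrossing_limit.

(** * Folding chains at an extremal point *)

(** For an increasing pair, the continuum of the first pair reaching [v] and the
    continuum of the second pair reaching [w'] could not be comparable. *)
Lemma crossing_antitone (R : realType) (X : topologicalType) (u : X -> R) (x : X) :
  (forall A B : set X, closed A -> connected A -> A x ->
     closed B -> connected B -> B x -> A `<=` B \/ B `<=` A) ->
  forall v w v' w', crossing_continua u x v w -> crossing_continua u x v' w' ->
    v < v' -> w < w' -> False.
Proof.
move=> cmp v w v' w' [A [_ [[clA cA Ax Aw [c Ac cv]] _]]].
move=> [_ [B [_ [clB cB Bx Bv [c' Bc' cw]]]]] vv ww.
have [AB|BA] := cmp A B clA cA Ax clB cB Bx.
  by have /= := Bv c (AB c Ac); rewrite leNgt (le_lt_trans cv vv).
by have /= := Aw c' (BA c' Bc'); rewrite leNgt (lt_le_trans ww cw).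
Qed.

(** Merging the links with the same folded position gives a chain whose links
    are small because [f] is determined by the position.  Since [x] may also
    belong to a neighbour of the link [k], at position 1, the positions 0 and 1
    are put together by [Q] in the first link. *)
Lemma folded_chain_endpoint (R : realType) (X : metricType R) (d : seq (set X))
    (y : nat -> X) (k : nat) (x : X) (P : nat -> nat) (f : nat -> int) (e : R) :
  is_chain d -> covers d -> 0 < e -> (mesh d < (e / 8)%:E)%E ->
  link d k x -> (forall i, (i < size d)%N -> link d i (y i)) ->
  steps1 (size d).-1 f ->
  (forall i j, `|f i - f j| <= 1 -> mdist (y i) (y j) < e / 4) ->
  P k = 0%N ->
  (forall t, (t.+1 < size d)%N -> (P t.+1 <= (P t).+1)%N /\ (P t <= (P t.+1).+1)%N) ->
  (forall s t, (s < size d)%N -> (t < size d)%N -> P s = P t -> f s = f t) ->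
  exists d' : seq (set X), [/\ eps_chain e d', covers d'
    & forall i : 'I_(size d'), link d' i x <-> i = 0%N :> nat].
Proof.
move=> dc dT e0 de kx yi f1 fy Pk P1 Pf; have kd := link_lt_size kx.
pose Q t := (P t).-1.
have Q1 t : (t.+1 < size d)%N -> (Q t.+1 <= (Q t).+1)%N /\ (Q t <= (Q t.+1).+1)%N.
  by move=> /P1; rewrite /Q; lia.
have f01 i j : (i < size d)%N -> (j < size d)%N -> P i = 0%N -> P j = 1%N ->
    `|f i - f j| <= 1.
  move=> id jd Pi Pj; have Pj0 : (0 < P j)%N by rewrite Pj.
  have [i' [j' [id' jd' [ij ji] Pi' Pj']]] := walk_crosses_level P1 kd jd Pk Pj0.
  rewrite (Pf i i') ?Pi ?Pi' // (Pf j j') ?Pj ?Pj' //.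
  have [ij'|[ij'|ij']] : i' = j' \/ i' = j'.+1 \/ j' = i'.+1 by lia.
  - by rewrite ij' subrr.
  - by rewrite ij'; apply: f1; lia.
  - by rewrite ij' distrC; apply: f1; lia.
have fQ i j : (i < size d)%N -> (j < size d)%N -> Q i = Q j -> `|f i - f j| <= 1.
  move=> id jd; rewrite /Q => Qij.
  have [Pij|[[Pi Pj]|[Pi Pj]]] : P i = P j \/ (P i = 0%N /\ P j = 1%N) \/
    (P i = 1%N /\ P j = 0%N) by lia.
  - by rewrite (Pf i j id jd Pij) subrr.
  - exact: f01.
  - by rewrite distrC; exact: f01.
exists (merge_links d Q); split.
- split; first by apply: (@merge_links_chain _ _ _ k) => //; rewrite /Q Pk.
  apply: (@le_lt_trans _ _ (e / 2)%:E); last by rewrite lte_fin; lra.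
  apply: mesh_le; first by rewrite divr_ge0 // ltW.
  move=> r p q /link_merge[i Qi ip] /link_merge[j Qj jq].
  have id := link_lt_size ip; have jd := link_lt_size jq.
  have ij : mdist (y i) (y j) < e / 4 by apply: fy; apply: fQ; rewrite // Qi.
  have pi := mesh_lt_dist de ip (yi i id); have qj := mesh_lt_dist de (yi j jd) jq.
  have t1 := metric_triangle p (y i) q; have t2 := metric_triangle (y i) (y j) q.
  lra.
- exact: merge_links_covers.
- move=> [i im] /=; split=> [/link_merge[j <- jx]|->].
    have [jk kj] := chain_adjacent dc jx kx; have jd := link_lt_size jx.
    have P0 : (P j <= 1)%N.
      have [jk'|[jk'|jk']] : j = k \/ j = k.+1 \/ k = j.+1 by lia.
      - by rewrite jk' Pk.
      - by subst j; have := P1 k jd; rewrite Pk; lia.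
      - by subst k; have := P1 j kd; rewrite Pk; lia.
    by rewrite /Q; lia.
  by apply/link_merge; exists k; rewrite ?/Q ?Pk.
Qed.

Lemma extremal_endpoint (R : realType) (X : metricType R) D U (x : X) :
  compact [set: X] -> vanishing_chain_covers D -> UltraFilter U -> nonprincipal U ->
  minimal (ultra_le D U) x \/ maximal (ultra_le D U) x -> endpoint x.
Proof.
move=> cX vD UU npU ext e e0.
(* Points in blocks at distance at most 1 differ by at most 3 in [u], so they are
   at distance less than [6 * (e / 24) = e / 4]; with the sizes [e / 8] of the two
   links sampled at these points, merged links have diameter at most [e / 2]. *)
have e24 : 0 < e / 24 by rewrite divr_gt0.
have [n0 de0] := filter_ex (mesh_ultra vD UU npU e24).
have [u0 cu0 u0_dist] := chain_coordinate (vD.1 n0).1 (vD.1 n0).2 de0.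
pose u z := u0 z - u0 x.
have cu : continuous u.
  by move=> z; apply: cvgB; [exact: cu0 | exact: cvg_cst].
have ux : u x = 0 by rewrite /u subrr.
have u_dist p q : `|u p - u q| <= 3 -> mdist p q < e / 4.
  rewrite /u (_ : u0 p - _ - _ = u0 p - u0 q); last by lra.
  by move=> /u0_dist; lra.
have cmp A B clA cA Ax clB cB Bx :=
  @extremal_comparable _ _ D U x A B vD UU npU ext clA cA Ax clB cB Bx.
have [a [b [a01 b01 generic]]] := generic_shifts (@crossing_antitone _ _ u x cmp).
have [k xk] : {k : nat -> nat & forall n, link (D n) (k n) x}.
  apply: (@choice _ _ (fun n k => link (D n) k x)) => n.
  exact: covers_link (vD.1 n).2.
(* Each link is sampled at one point, which is [x] in the link [k]. *)
have [y hy] : {y : nat -> nat -> X & forall n i,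
    (y n (k n) = x) /\ ((i < size (D n))%N -> link (D n) i (y n i))}.
  apply: (@choice _ _ (fun n y => forall i,
    (y (k n) = x) /\ ((i < size (D n))%N -> link (D n) i (y i)))) => n.
  have [y hy] : {y : nat -> X & forall i,
      (i < size (D n))%N -> link (D n) i (y i)}.
    apply: (@choice _ _ (fun i y => (i < size (D n))%N -> link (D n) i y)) => i.
    have [id|di] := ltnP i (size (D n)); last by exists x.
    have [p [pi _]] := chain_meet (vD.1 n).1 id id (leqnSn i) (leqnSn i).
    by exists p.
  exists (fun i => if i == k n then x else y i) => i; rewrite eqxx; split=> // id.
  by case: eqP => [->|_]; [exact: xk | exact: hy].
have yk n : y n (k n) = x by have [] := hy n 0%N.
have yi n i : (i < size (D n))%N -> link (D n) i (y n i) by have [] := hy n i.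
pose M n := (size (D n)).-1.
have kM n : (k n <= M n)%N by have := link_lt_size (xk n); rewrite /M; lia.
have fine r : 0 < r -> U [set n | forall j, (j < M n)%N -> mdist (y n j) (y n j.+1) < r].
  move=> r0; have r20 : 0 < r / 2 by rewrite divr_gt0.
  apply: filterS (mesh_ultra vD UU npU r20) => n nr j jM.
  have j1 : (j.+1 < size (D n))%N by move: jM; rewrite /M; lia.
  have := @chain_dist _ _ _ _ j 1 (y n j) (y n j.+1) (vD.1 n).1 nr (yi n j (ltnW j1)).
  by rewrite addn1 => /(_ (yi n _ j1)); rewrite mulrC divfK.
have e8 : 0 < e / 8 by rewrite divr_gt0.
have nc := eventually_noncrossing UU cX cu ux a01 b01 generic yk kM fine.
have ncN := eventually_noncrossing_opp UU cX cu ux a01 b01 generic yk kM fine.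
have st := eventually_steps1 UU cX cu a01 b01 fine.
have [n [[/= ncn ncNn] [/= stn den]]] := filter_ex
  (filterI (filterI nc ncN) (filterI st (mesh_ultra vD UU npU e8))).
have [P [Pk P1 Pf]] := fold_walk (kM n) stn ncn ncNn.
have [dc dT] := vD.1 n.
apply: (folded_chain_endpoint dc dT e0 den (xk n) (yi n) stn _ Pk).
- by move=> i j /(block_width a01 b01) /u_dist.
- by move=> t td; apply: P1; rewrite /M; lia.
- by move=> s t sd td; apply: Pf; rewrite /M; lia.
Qed.

Theorem theorem8p2 (R : realType) (X : metricType R)
    (hX : continuum X) (hc : chainable X) (x : X) :
  (endpoint x <->
     exists r : X -> X -> Prop,
       ultrafilter_order r /\ (minimal r x \/ maximal r x)) /\
  (absolute_endpoint x ->
     forall r : X -> X -> Prop,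
       ultrafilter_order r -> minimal r x \/ maximal r x).
Proof.
split; [split|].
- by move=> /endpoint_minimal[r [ru rm]]; exists r; split=> //; left.
- move=> [_ [[D [U [vD UU npU ->]]] ext]].
  exact: extremal_endpoint hX.1 vD UU npU ext.
- move=> ax _ [D [U [vD UU npU ->]]].
  exact: absolute_endpoint_extremal.
Qed.
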